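(* An element $\Psi\in\mathcal{V}$ has a strict multiplicative inverse $\Psi^{-1}\in\mathcal{V}$ under the pointwise product $\otimes$ if and only if $\Psi$ is nodeless (nowhere-vanishing on its principal sequence): $$\Psi[m]\ne0\quad\text{for all }m\in\{1,\dots,\operatorname{per}(\Psi)\}.$$ The set of all such nodeless periodic wave numbers forms an abelian multiplicative group under $\otimes$, denoted the unit group $\mathcal{U}(\mathcal{V})=\mathcal{V}^\times$. Moreover: (1) (Subgroup of pure carriers) The group of rational plane wave carriers $\mathcal{G}=\{\mathbf{w}(f,g)\mid f\in\mathbb{Q}/\mathbb{Z},\,g\in\mathbb{Q}\}$ forms a proper subgroup of $\mathcal{U}(\mathcal{V})$ consisting entirely of unitary elements: $$\mathcal{I}_{\mathrm{inv}}(\mathbf{w}(f,g))=\overline{\mathbf{w}(f,g)}=\mathbf{w}(-f,-g).$$ (2) (Embedded scalar field) The set of spatially constant, non-zero waves forms a subfield isomorphic to $\mathbb{C}^\times$: $$\mathbb{W}_{\mathbb{C}}:=\{c\,\mathbf{w}(0,0)\mid c\in\mathbb{C}^\times\}\cong\mathbb{C}^\times,\qquad\mathbb{W}_{\mathbb{Q}}:=\{q\,\mathbf{w}(0,0)\mid q\in\mathbb{Q}^\times\}\cong\mathbb{Q}^\times.$$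
   Context: For $f\in\mathbb{Q}/\mathbb{Z}$ and $g\in\mathbb{Q}$, $\mathbf{w}(f,g):\mathbb{Z}\to\mathbb{C}$ is the sequence $\mathbf{w}(f,g)[m]=\exp(2\pi i(fm+g))$. $\mathcal{V}=\operatorname{span}_{\mathbb{C}}\{\mathbf{w}(f,g)\mid f\in\mathbb{Q}/\mathbb{Z},\,g\in\mathbb{Q}\}$ is a commutative ring under pointwise addition and pointwise multiplication $\otimes$, with unit $\mathbf{1}=\mathbf{w}(0,0)$. Every $\Psi\in\mathcal{V}$ is periodic; $\operatorname{per}(\Psi)$ denotes its fundamental period, and its principal sequence is $(\Psi[1],\dots,\Psi[\operatorname{per}(\Psi)])$. For nowhere-vanishing $\Psi$, $\mathcal{I}_{\mathrm{inv}}(\Psi)$ is the pointwise inverse, $(\mathcal{I}_{\mathrm{inv}}\Psi)[m]=1/\Psi[m]$. The bar denotes pointwise complex conjugation.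
   Formalization: The nonzero constant waves exclude 0, so they are not literally a subfield; proved instead: the nonzero sets are abelian groups isomorphic to the multiplicative groups of C and Q, and with 0 adjoined they are subfields isomorphic to C and Q. *)

(* Defs.v *)
From HB Require Import structures.
From mathcomp Require Import all_boot all_order all_algebra.
From mathcomp Require Import generic_quotient ring_quotient.
From mathcomp Require Import complex.
From mathcomp Require Import boolp classical_sets functions reals trigo.

Set Implicit Arguments.
Unset Strict Implicit.
Unset Printing Implicit Defensive.

Import Order.TTheory GRing.Theory Num.Theory.

Local Open Scope ring_scope.
Local Open Scope quotient_scope.
Local Open Scope classical_set_scope.

Definition int_in_rat : {pred rat} := [pred x | x \is a Num.int].

Fact int_in_rat_zmod : zmod_closed int_in_rat.
Proof. by split=> [|x y]; rewrite !inE ?rpred0 //; apply: rpredB. Qed.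

HB.instance Definition _ :=
  GRing.isZmodClosed.Build rat int_in_rat int_in_rat_zmod.

Definition QmodZ := Quotient.quot int_in_rat.

HB.instance Definition _ := GRing.Zmodule.on QmodZ.

Section Waves.
Variable R : realType.
Local Notation C := R[i].

(* exp (2 pi i x) for real x, by Euler's formula. *)
Definition e2pi (x : R) : C := (cos (pi *+ 2 * x) +i* sin (pi *+ 2 * x))%C.

(* [repr f] is a rational representative of the class [f]; the choice is
   irrelevant, see [wave_pi]. *)
Definition wave (f : QmodZ) (g : rat) : int -> C :=
  fun m => e2pi (ratr (repr f) * m%:~R + ratr g).

Lemma e2piD x y : e2pi (x + y) = e2pi x * e2pi y.
Proof.
apply/eqP; rewrite eq_complex /= mulrDr cosD sinD eqxx /=.
by apply/eqP; rewrite addrC [in RHS]addrC addrC.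
Qed.

Lemma e2pi0 : e2pi 0 = 1.
Proof. by rewrite /e2pi mulr0 cos0 sin0. Qed.

Lemma e2pi1 : e2pi 1 = 1.
Proof. by rewrite /e2pi mulr1 cos2pi sin2pi. Qed.

Lemma e2pi_nat (n : nat) : e2pi n%:R = 1.
Proof.
elim: n => [|n IHn]; first exact: e2pi0.
by rewrite -natr1 e2piD IHn e2pi1 mulr1.
Qed.

Lemma e2pi_int (k : int) : e2pi k%:~R = 1.
Proof.
case: (intP k) => [|n|n]; rewrite ?e2pi0 //; first exact: e2pi_nat.
have := e2piD (- n.+1%:R) n.+1%:R.
by rewrite addNr e2pi0 e2pi_nat mulr1 intrN => ->.
Qed.

Lemma e2pi_ratr_int (q : rat) : q \is a Num.int -> e2pi (ratr q) = 1.
Proof. by move=> /intrP[k ->]; rewrite ratr_int e2pi_int. Qed.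

Lemma wave_pi (f g : rat) (m : int) :
  wave (\pi f) g m = e2pi (ratr f * m%:~R + ratr g).
Proof.
have fZ : repr (\pi_QmodZ f) - f \is a Num.int.
  by have := Quotient.idealrBE int_in_rat (repr (\pi_QmodZ f)) f;
     rewrite reprK eqxx => ->.
rewrite /wave -[in LHS](subrK f (repr _)) rmorphD /= mulrDl -addrA e2piD.
rewrite -(ratr_int R m) -rmorphM /= e2pi_ratr_int ?mul1r //.
by rewrite rpredM // rpred_int.
Qed.

Lemma waveM f g f' g' : wave f g * wave f' g' = wave (f + f') (g + g').
Proof.
have -> : f + f' = \pi_QmodZ (repr f + repr f').
  by rewrite [RHS]Quotient.pi_add !reprK.
apply/funext => m; rewrite wave_pi /wave mulrfctE -e2piD.
by rewrite !rmorphD /= mulrDl addrACA.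
Qed.

Lemma wave0 : wave 0 0 = 1.
Proof.
have -> : 0 = \pi_QmodZ 0 by rewrite piE.
by apply/funext => m; rewrite wave_pi !rmorph0 mul0r addr0 e2pi0.
Qed.

Definition wave_span : {pred int -> C} := [pred Psi | `[<
  exists s : seq (C * QmodZ * rat),
    Psi = \sum_(x <- s) x.1.1 *: wave x.1.2 x.2 >]].

Lemma wave_spanP Psi : reflect
  (exists s : seq (C * QmodZ * rat),
    Psi = \sum_(x <- s) x.1.1 *: wave x.1.2 x.2)
  (Psi \in wave_span).
Proof. exact: asboolP. Qed.

Lemma wave_in_span f g : wave f g \in wave_span.
Proof.
by apply/wave_spanP; exists [:: (1, f, g)]; rewrite big_seq1 /= scale1r.
Qed.

Fact wave_span_submod : subsemimod_closed wave_span.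
Proof.
split=> [|a _ /wave_spanP[s ->]]; first split.
- by apply/wave_spanP; exists [::]; rewrite big_nil.
- move=> _ _ /wave_spanP[s ->] /wave_spanP[t ->]; apply/wave_spanP.
  by exists (s ++ t); rewrite big_cat.
- apply/wave_spanP; exists [seq (a * x.1.1, x.1.2, x.2) | x <- s].
  by rewrite big_map scaler_sumr; apply: eq_bigr => x _; rewrite scalerA.
Qed.

Fact wave_span_subring : subring_closed wave_span.
Proof.
have [[S0 SD] SZ] := wave_span_submod; split.
- by rewrite -wave0 wave_in_span.
- by move=> u v Su Sv; rewrite -scaleN1r; apply: SD => //; apply: SZ.
- move=> _ _ /wave_spanP[s ->] /wave_spanP[t ->].
  rewrite mulr_suml; elim/big_ind: _ => // x _.
  rewrite mulr_sumr; elim/big_ind: _ => // y _.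
  have -> : (x.1.1 *: wave x.1.2 x.2) * (y.1.1 *: wave y.1.2 y.2)
      = (x.1.1 * y.1.1) *: wave (x.1.2 + y.1.2) (x.2 + y.2).
    by rewrite -waveM; apply/funext => m; rewrite !fctE /= [LHS]mulrACA.
  exact/SZ/wave_in_span.
Qed.

Record wave_number := WaveNumber {
  wave_seq :> int -> C;
  wave_seqP : wave_seq \in wave_span }.

HB.instance Definition _ := [isSub for wave_seq].
HB.instance Definition _ := [Choice of wave_number by <:].
HB.instance Definition _ := GRing.SubChoice_isSubComPzRing.Build
  (int -> C) wave_span wave_number wave_span_subring.
HB.instance Definition _ := GRing.SubZmodule_isSubLmodule.Build
  C (int -> C) wave_span wave_number wave_span_submod.

Fact wave_number_neq0 : (1 : wave_number) != 0.
Proof.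
apply/eqP => /(congr1 (fun Psi : wave_number => Psi 0)) /eqP.
by rewrite (oner_eq0 C).
Qed.

HB.instance Definition _ :=
  GRing.PzSemiRing_isNonZero.Build wave_number wave_number_neq0.

Definition wave_unit : {pred wave_number} :=
  [pred Psi | `[< exists Phi, Phi * Psi = 1 >]].

Definition wave_inv (Psi : wave_number) : wave_number :=
  if pselect (exists Phi, Phi * Psi = 1) is left ex then projT1 (cid ex)
  else Psi.

Fact wave_mulVx : {in wave_unit, left_inverse 1 wave_inv *%R}.
Proof.
move=> Psi /asboolP ex; rewrite /wave_inv.
by case: pselect => // ex'; exact: projT2 (cid ex').
Qed.

Fact wave_unitPl Psi Phi : Phi * Psi = 1 -> wave_unit Psi.
Proof. by move=> PhiK; apply/asboolP; exists Phi. Qed.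

Fact wave_inv_out : {in [predC wave_unit], wave_inv =1 id}.
Proof.
by move=> Psi /asboolP nex; rewrite /wave_inv; case: pselect.
Qed.

HB.instance Definition _ := GRing.ComNzRing_hasMulInverse.Build
  wave_number wave_mulVx wave_unitPl wave_inv_out.

Definition w (f : QmodZ) (g : rat) : wave_number :=
  WaveNumber (wave_in_span f g).

Definition is_period (Psi : int -> C) (p : nat) :=
  (0 < p)%N /\ forall m : int, Psi (m + p%:Z) = Psi m.

Lemma is_period_mul Psi p k :
  is_period Psi p -> (0 < k)%N -> is_period Psi (k * p)%N.
Proof.
move=> [p0 pP] k0; split=> [|m]; first by rewrite muln_gt0 k0.
elim: k m {k0} => [|k IHk] m; first by rewrite mul0n addr0.
by rewrite mulSn addnC PoszD addrA pP IHk.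
Qed.

Lemma wave_period f g : is_period (wave f g) `|denq (repr f)|%N.
Proof.
split=> [|m]; first by rewrite absz_gt0 denq_eq0.
rewrite /wave absz_denq intrD mulrDr -addrA [X in _ + X]addrC addrA e2piD.
rewrite -(ratr_int R (denq _)) -rmorphM /= e2pi_ratr_int ?mulr1 //.
by rewrite -[X in X * _]divq_num_den mulfVK ?intr_eq0 ?denq_eq0 // rpred_int.
Qed.

Lemma wave_number_periodic (Psi : wave_number) :
  exists p, `[< is_period Psi p >].
Proof.
case: Psi => _ /= /wave_spanP[s ->].
elim: s => [|x s [p /asboolP pP]].
  by exists 1%N; apply/asboolP; split=> // m; rewrite big_nil.
pose q := `|denq (repr x.1.2)|%N; exists (p * q)%N; apply/asboolP.
have [q0 _] := wave_period x.1.2 x.2; have [p0 _] := pP.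
have [_ xP] := is_period_mul (wave_period x.1.2 x.2) p0.
have [_ sP] := is_period_mul pP q0.
split=> [|m]; first by rewrite muln_gt0 p0.
rewrite big_cons !addrfctE; congr (_ + _); last by rewrite mulnC sP.
by rewrite !scalrfctE xP.
Qed.

Definition per (Psi : wave_number) : nat := ex_minn (wave_number_periodic Psi).

Definition nodeless (Psi : wave_number) :=
  forall m : nat, (1 <= m <= per Psi)%N -> Psi m%:Z != 0.

Definition I_inv (Psi : int -> C) : int -> C := fun m => (Psi m)^-1.

Definition conj_seq (Psi : int -> C) : int -> C := fun m => (Psi m)^*.

End Waves.

Arguments w {R} f g.

Definition units (A : unitRingType) : set A := [set x | x \is a GRing.unit].
Arguments units A _ : clear implicits.

(* [divr_closed S] only says that [1 \in S] and that [x / y \in S] for [x], [y]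
   in [S]; it makes [S] a group because [S] consists of units, on which [/] is
   genuine division. *)
Definition abelian_mul_group (A : unitRingType) (S : set A) :=
  [/\ S `<=` units A, divr_closed (mem S) & {in S &, commutative *%R}].

Definition mul_group_isog (A B : unitRingType) (S : set A) (T : set B) :=
  exists2 phi : A -> B,
    set_bij S T phi & {in S &, {morph phi : x y / x * y}}.

(* Closure under [x / 0] is harmless, since [0^-1 = 0] in a [unitRingType]. *)
Definition is_subfield (A : comUnitRingType) (S : set A) :=
  divring_closed (mem S) /\ forall x, S x -> x != 0 -> x \is a GRing.unit.

Definition field_isog (F : fieldType) (A : comUnitRingType) (S : set A) :=
  exists phi : {rmorphism F -> A}, set_bij [set: F] S phi.

Section Subsets.
Variable R : realType.

Definition carriers : set (wave_number R) :=
  [set Psi | exists f g, Psi = w f g].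

(* [W_C] and [W_Q] are multiplicative groups and do not contain 0: the
   corresponding fields are [0 |` W_C] and [0 |` W_Q]. *)
Definition W_C : set (wave_number R) :=
  [set Psi | exists2 c : R[i], c != 0 & Psi = c *: w 0 0].

Definition W_Q : set (wave_number R) :=
  [set Psi | exists2 q : rat, q != 0 & Psi = (ratr q : R[i]) *: w 0 0].

End Subsets.

(* Main.v *)
Require Import Defs.
From HB Require Import structures.
From mathcomp Require Import all_boot all_order all_algebra.
From mathcomp Require Import generic_quotient ring_quotient.
From mathcomp Require Import complex.
From mathcomp Require Import boolp classical_sets functions reals trigo.

(** The heart of the theorem is that a nodeless wave has its inverse inside the
    span of the carriers. A wave [Psi] of period [p] takes only the values
    [Psi 1], ..., [Psi p], so it is a root of the split polynomial
    [\prod_k ('X - Psi k)], whose coefficients are constant waves. If [Psi] is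
    nodeless, the constant term of this polynomial
    is a unit, and the relation exhibits [Psi] as a divisor of that unit: the
    inverse of [Psi] is a polynomial in [Psi] ([prod_subr_eq0_unit],
    [nodelessP]). Conversely a product that is 1 vanishes nowhere.

    The carriers multiply by adding their parameters, whence their inverses;
    these are also the conjugates, as [e2pi] sends opposites to conjugates.
    A carrier therefore has values of modulus 1, so the constant 2 is a unit
    that is no carrier ([carriers_proper]).

    Finally [W_C] and [W_Q] are the images of the nonzero scalars under two
    ring morphisms from a field to the ring of waves, [wave_const] and
    [wave_const \o ratr]. All the claims on groups, subfields and isomorphisms
    hold for every such image, because a morphism out of a field is injective
    and preserves inverses. *)

Import Order.TTheory GRing.Theory Num.Theory.
Local Open Scope ring_scope.
Local Open Scope classical_set_scope.

(** * Units annihilated by a split polynomial *)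

(** Modulo [x], every factor [x - c] is [- c]. *)
Lemma prod_subr_const {A : comPzRingType} (x : A) (s : seq A) :
  exists y, \prod_(c <- s) (x - c) = \prod_(c <- s) (- c) + x * y.
Proof.
elim: s => [|c s [y IHs]]; first by exists 0; rewrite !big_nil mulr0 addr0.
exists (\prod_(d <- s) (x - d) - c * y).
rewrite !big_cons mulrBl {2}IHs mulrDr mulrBr mulNr opprD addrCA.
by rewrite (mulrCA x).
Qed.

(** The constant term of [\prod_(c <- s) ('X - c)] is a unit and, as this
    polynomial vanishes at [x], a multiple of [x]. *)
Lemma prod_subr_eq0_unit {A : comUnitRingType} (x : A) (s : seq A) :
  all (fun c => c \is a GRing.unit) s -> \prod_(c <- s) (x - c) = 0 ->
  x \is a GRing.unit.
Proof.
move=> /allP sU; have [y ->] := prod_subr_const x s.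
move=> /eqP; rewrite addr_eq0 => /eqP xy.
have : \prod_(c <- s) - c \is a GRing.unit.
  by rewrite big_seq; apply: rpred_prod => c cs; rewrite unitrN sU.
by rewrite xy unitrN unitrM => /andP[].
Qed.

(** * Multiplicative groups and fields inside a ring *)

Lemma units_abelian (A : comUnitRingType) : abelian_mul_group (units A).
Proof.
split=> // [|x y _ _]; last exact: mulrC.
split=> [|x y]; rewrite !inE /units /= ?unitr1 // => xU yU.
by rewrite unitrM xU unitrV.
Qed.

Section FieldImage.
Variables (F : fieldType) (A : comUnitRingType) (phi : {rmorphism F -> A}).

Lemma image_units_abelian : abelian_mul_group (phi @` units F).
Proof.
split=> [_ [c cU <-]||x y _ _]; last exact: mulrC.
  exact: rmorph_unit.
split=> [|x y].
  by rewrite inE; exists 1; rewrite ?rmorph1 //; apply: unitr1.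
rewrite !inE => -[c cU <-] [d dU <-]; exists (c / d).
  by rewrite /units /= unitrM cU unitrV.
by rewrite rmorphM /= rmorphV.
Qed.

Lemma image_units_isog : mul_group_isog (units F) (phi @` units F).
Proof.
exists phi => [|x y _ _]; last exact: rmorphM.
by split=> // c d _ _; apply: fmorph_inj.
Qed.

(** Adding 0 back to the image of the nonzero scalars gives the whole range of
    [phi], which reduces the claims on fields to facts on ring morphisms. *)
Lemma setU0_image_units : 0 |` (phi @` units F) = range phi.
Proof.
apply/seteqP; split=> [_ [->|[c _ <-]]|_ [c _ <-]].
- by exists 0; rewrite ?rmorph0.
- by exists c.
- have [->|c0] := eqVneq c 0; first by left; rewrite rmorph0.
  by right; exists c; rewrite // /units /= unitfE.
Qed.

Lemma image_subfield : is_subfield (0 |` (phi @` units F)).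
Proof.
rewrite setU0_image_units; split=> [|_ [c _ <-]]; last first.
  by rewrite fmorph_eq0 fmorph_unit.
split=> [|x y|x y]; rewrite !inE.
- by exists 1; rewrite ?rmorph1.
- by move=> [c _ <-] [d _ <-]; exists (c - d); rewrite ?rmorphB.
- by move=> [c _ <-] [d _ <-]; exists (c / d); rewrite ?fmorph_div.
Qed.

Lemma image_field_isog : field_isog F (0 |` (phi @` units F)).
Proof.
rewrite setU0_image_units; exists phi; split=> //.
by move=> c d _ _; apply: fmorph_inj.
Qed.

End FieldImage.

(** * Constant waves *)

Section Waves.
Variable R : realType.
Implicit Types (Psi Phi : wave_number R) (c : R[i]).

Lemma wave_number_ext Psi Phi : (forall m, Psi m = Phi m) -> Psi = Phi.
Proof. by move=> eqPP; apply/val_inj/funext. Qed.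

Lemma wave_numberM Psi Phi m : (Psi * Phi) m = Psi m * Phi m.
Proof. by []. Qed.

Lemma wave_numberB Psi Phi m : (Psi - Phi) m = Psi m - Phi m.
Proof. by []. Qed.

Lemma w00 : w 0 0 = 1 :> wave_number R.
Proof. by apply: val_inj; rewrite /= wave0. Qed.

Definition wave_const c : wave_number R := c *: (1 : wave_number R).

Lemma wave_constE c m : wave_const c m = c.
Proof. exact: mulr1. Qed.

Fact wave_const_zmod_morphism : zmod_morphism wave_const.
Proof. by move=> c d; rewrite /wave_const scalerBl. Qed.

Fact wave_const_monoid_morphism : monoid_morphism wave_const.
Proof.
split=> [|c d]; first exact: scale1r.
by apply: wave_number_ext => m; rewrite wave_numberM !wave_constE.
Qed.

HB.instance Definition _ := GRing.isZmodMorphism.Build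
  R[i] (wave_number R) wave_const wave_const_zmod_morphism.
HB.instance Definition _ := GRing.isMonoidMorphism.Build
  R[i] (wave_number R) wave_const wave_const_monoid_morphism.

Lemma W_C_image : @W_C R = wave_const @` units R[i].
Proof.
apply/seteqP; split=> [_ [c c0 ->]|_ [c cU <-]]; exists c.
- by rewrite /units /= unitfE.
- by rewrite w00.
- by rewrite -unitfE.
- by rewrite w00.
Qed.

Lemma W_Q_image : @W_Q R = (wave_const \o ratr) @` units rat.
Proof.
apply/seteqP; split=> [_ [c c0 ->]|_ [c cU <-]]; exists c.
- by rewrite /units /= unitfE.
- by rewrite w00.
- by rewrite -unitfE.
- by rewrite w00.
Qed.

(** A wave [Psi] with constant values is the multiple by [Psi 0] of 1, so the
    scalar is read off at any one position. *)
Lemma W_C_constant : @W_C R =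
  [set Psi | Psi != 0 /\ forall m n : int, Psi m = Psi n].
Proof.
rewrite W_C_image; apply/seteqP; split=> [_ [c cU <-]|Psi [Psi0 PsiC]].
  split=> [|m n]; last by rewrite !wave_constE.
  apply: contraTneq cU => /(congr1 (fun f : int -> R[i] => f 0)).
  by rewrite wave_constE => ->; rewrite unitr0.
have PsiE : wave_const (Psi 0) = Psi.
  by apply: wave_number_ext => m; rewrite wave_constE.
exists (Psi 0) => //; rewrite /units /= unitfE.
by apply: contra_neq Psi0 => Psi00; apply/funext => m; rewrite (PsiC m 0).
Qed.

(** * Nodeless waves are the units *)

Lemma per_is_period Psi : is_period Psi (per Psi).
Proof. by rewrite /per; case: ex_minnP => p /asboolP. Qed.

Lemma is_periodMz (f : int -> R[i]) (p : nat) (k m : int) :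
  is_period f p -> f (m + k * p%:Z) = f m.
Proof.
move=> [_ fP]; elim/int_ind: k => [|n IHn|n IHn]; first by rewrite mul0r addr0.
  by rewrite intS mulrDl mul1r addrCA addrC fP.
by rewrite -fP intS opprD mulrDl mulN1r -addrA (addrAC (- _)) addNr add0r.
Qed.

(** The fundamental period carries every value of [Psi] to a position of the
    principal sequence, which starts at 1: the remainder is taken of [m - 1]. *)
Lemma principal_value Psi m :
  exists2 k : nat, (1 <= k <= per Psi)%N & Psi m = Psi k%:Z.
Proof.
have PsiP := per_is_period Psi; have [p0 _] := PsiP.
have r0 : (0 <= (m - 1) %% (per Psi)%:Z)%Z by apply: modz_ge0; case: per p0.
have rp : ((m - 1) %% (per Psi)%:Z < (per Psi)%:Z)%Z by apply: ltz_pmod.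
have := divz_eq (m - 1) (per Psi)%:Z.
case: modz r0 rp => // k _ kp mE; exists k.+1; first exact: kp.
by rewrite -(subrK 1 m) mE -addrA (addrC k%:Z) -intS addrC is_periodMz.
Qed.

(** A nodeless [Psi] is annihilated by the split polynomial whose roots are the
    constant waves at the values of its principal sequence: at each position,
    one of the factors vanishes. *)
Lemma nodelessP Psi : nodeless Psi <-> Psi \is a GRing.unit.
Proof.
split=> [Psi0|/mulrV PsiV m _]; last first.
  apply/negP => /eqP Psi0; have := wave_numberM Psi Psi^-1 m.
  by rewrite PsiV Psi0 mul0r => /eqP; rewrite (oner_eq0 R[i]).
pose s := [seq wave_const (Psi k%:Z) | k <- iota 1 (per Psi)].
apply: (@prod_subr_eq0_unit _ Psi s).
  apply/allP => c /mapP[k + ->]; rewrite mem_iota add1n ltnS => /Psi0 Psik.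
  by rewrite rmorph_unit // unitfE.
apply: wave_number_ext => m; have [k kP mk] := principal_value Psi m.
rewrite /s big_map (big_rem k); last by rewrite mem_iota add1n ltnS.
by rewrite wave_numberM wave_numberB wave_constE mk subrr mul0r.
Qed.

Lemma inverse_nodeless Psi : (exists Phi, Psi * Phi = 1) <-> nodeless Psi.
Proof.
rewrite nodelessP; split=> [[Phi PsiK]|PsiU].
  by apply/unitrPr; exists Phi.
by exists Psi^-1; apply: mulrV.
Qed.

(** * Carriers *)

Lemma wM f g f' g' : w f g * w f' g' = w (f + f') (g + g') :> wave_number R.
Proof. by apply: val_inj; rewrite /= -waveM. Qed.

Lemma wVr f g : w f g * w (- f) (- g) = 1 :> wave_number R.
Proof. by rewrite wM !subrr w00. Qed.

Lemma w_unit f g : @w R f g \is a GRing.unit.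
Proof. by apply/unitrPr; exists (w (- f) (- g)); apply: wVr. Qed.

Lemma wV f g : (w f g)^-1 = w (- f) (- g) :> wave_number R.
Proof. by apply: (mulrI (w_unit f g)); rewrite wVr mulrV ?w_unit. Qed.

Lemma carriers_abelian : abelian_mul_group (@carriers R).
Proof.
split=> [_ [f [g ->]]||x y _ _]; [exact: w_unit | | exact: mulrC].
split=> [|x y]; first by rewrite inE; exists 0, 0; rewrite w00.
rewrite !inE => -[f [g ->]] [f' [g' ->]].
by exists (f - f'), (g - g'); rewrite wV wM.
Qed.

Lemma conj_e2pi (x : R) : (e2pi x)^* = e2pi (- x).
Proof.
by apply/eqP; rewrite /e2pi mulrN cosN sinN eq_complex /= !eqxx.
Qed.

(** Since [\pi (- repr f)] is the class [- f], the wave [w (- f) _] can be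
    computed on the representative [- repr f], even though [repr (- f)] may
    differ from it. *)
Lemma conj_w f g : conj_seq (@w R f g) = w (- f) (- g).
Proof.
have -> : - f = \pi_QmodZ%qT (- repr f).
  by rewrite [RHS]Quotient.pi_opp reprK.
apply/funext => m; rewrite /= wave_pi /conj_seq /= conj_e2pi.
by rewrite opprD !rmorphN /= mulNr.
Qed.

Lemma I_inv_w f g : I_inv (@w R f g) = w (- f) (- g).
Proof.
apply/funext => m; apply: mulr1_eq.
by rewrite -wave_numberM wVr.
Qed.

(** The inverse and the conjugate of a carrier agree, while those of the
    constant 2 do not. *)
Lemma carriers_proper : @carriers R `<` units (wave_number R).
Proof.
split; first by case: carriers_abelian.
move=> sub.
have /sub[f [g /(congr1 (fun Psi : wave_number R => Psi 0))]] :
    units (wave_number R) (wave_const 2).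
  by apply: rmorph_unit; rewrite unitfE pnatr_eq0.
rewrite wave_constE => w2.
have : conj_seq (@w R f g) 0 = I_inv (@w R f g) 0 by rewrite conj_w I_inv_w.
rewrite /conj_seq /I_inv -w2 conjC_nat => /(congr1 ( *%R 2)) /eqP.
by rewrite divff ?pnatr_eq0 // -natrM (eqr_nat _ 4 1).
Qed.

End Waves.

Theorem theorem10p2 (R : realType) :
  [/\ (forall Psi : wave_number R,
         (exists Phi : wave_number R, Psi * Phi = 1) <-> nodeless Psi),
      ([set Psi : wave_number R | nodeless Psi] = units (wave_number R)
       /\ abelian_mul_group [set Psi : wave_number R | nodeless Psi]),
      [/\ abelian_mul_group (@carriers R),
          @carriers R `<` units (wave_number R) &
          forall (f : QmodZ) (g : rat),
            I_inv (@w R f g) = conj_seq (w f g)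
            /\ conj_seq (@w R f g) = w (- f) (- g)],
      [/\ @W_C R = [set Psi : wave_number R |
                      Psi != 0 /\ forall m n : int, Psi m = Psi n],
          abelian_mul_group (@W_C R),
          mul_group_isog (units R[i]) (@W_C R),
          is_subfield (0 |` @W_C R) &
          field_isog R[i] (0 |` @W_C R)] &
      [/\ abelian_mul_group (@W_Q R),
          mul_group_isog (units rat) (@W_Q R),
          is_subfield (0 |` @W_Q R) &
          field_isog rat (0 |` @W_Q R)]].
Proof.
have nodelessE :
    [set Psi : wave_number R | nodeless Psi] = units (wave_number R).
  by apply/seteqP; split=> Psi /nodelessP.
split.
- exact: inverse_nodeless.
- by rewrite nodelessE; split=> //; apply: units_abelian.
- split; [exact: carriers_abelian | exact: carriers_proper |].
  by move=> f g; rewrite I_inv_w conj_w.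
- split; [exact: W_C_constant | rewrite W_C_image ..].
  + exact: image_units_abelian.
  + exact: image_units_isog.
  + exact: image_subfield.
  + exact: image_field_isog.
- rewrite W_Q_image; split.
  + exact: image_units_abelian.
  + exact: image_units_isog.
  + exact: image_subfield.
  + exact: image_field_isog.
Qed.
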